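(* Let $D$ be a positive integer. If $G$ is a 2-degenerate graph with $\Delta(G)\le D$, then $\omega(G^2)\le \frac52 D+72$. Furthermore, if $D\ge 1729$, then $\omega(G^2)\le \frac52 D+60$.
   Context: A graph is $k$-degenerate if every subgraph has a vertex of degree at most $k$ (equivalently, there is an ordering of its vertices in which each vertex has at most $k$ neighbors later in the order). The square $G^2$ of a graph $G$ is obtained from $G$ by adding an edge between every pair of vertices at distance 2 in $G$. $\omega(\cdot)$ denotes clique number and $\Delta(\cdot)$ maximum degree. *)

(* Defs.v *)
From mathcomp Require Import all_boot.
Set Implicit Arguments. Unset Strict Implicit. Unset Printing Implicit Defensive.

Definition simple_graph (T : finType) (e : rel T) : Prop :=
  symmetric e /\ irreflexive e.

Definition nbhd_in (T : finType) (e : rel T) (S : {set T}) (x : T) : {set T} :=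
  [set y in S | e x y].

Definition degree (T : finType) (e : rel T) (x : T) : nat :=
  #|nbhd_in e setT x|.

Definition max_degree_le (T : finType) (e : rel T) (D : nat) : Prop :=
  forall x : T, degree e x <= D.

Definition degenerate (T : finType) (e : rel T) (k : nat) : Prop :=
  forall S : {set T}, S != set0 -> exists2 v, v \in S & #|nbhd_in e S v| <= k.

Definition square_rel (T : finType) (e : rel T) : rel T :=
  fun x y => (x != y) && (e x y || [exists z, e x z && e z y]).

Definition is_clique (T : finType) (e : rel T) (K : {set T}) : Prop :=
  forall x y, x \in K -> y \in K -> x != y -> e x y.

Definition clique_number_le (T : finType) (e : rel T) (P : nat -> Prop) : Prop :=
  forall K : {set T}, is_clique e K -> P #|K|.

(* Main.v *)
Require Import Defs.
From mathcomp Require Import all_boot.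
From mathcomp Require Import zify.
Set Implicit Arguments. Unset Strict Implicit. Unset Printing Implicit Defensive.

(** Orient every edge of G from the earlier to the later endpoint in a
2-degeneracy order, so that out-degrees are at most 2. Two vertices of a
clique S of the square either have a common out-neighbour, or have a common
in-neighbour (at most D vertices y have one with a given x), or one reaches
the other by a directed path of length at most 2 (at most 6 vertices are
reached from a given x).

Call u big if at least D/2 vertices of S have u as an out-neighbour. If S is
larger than 5D/2 + 43, there are at most 12 big vertices, so the set Y of big
vertices and their out-neighbours has at most 36 elements. The first vertex x
of S \ Y that does not have two big out-neighbours would be reached only from
Y and would have too few neighbours in the square. Hence every vertex of S \ Y
has two big out-neighbours and reaches only elements of Y.

So S \ Y is the edge set of a multigraph of maximum degree at most D in which
every edge is disjoint from at most D others. Such a multigraph has at most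
5D/2 edges: otherwise every vertex has degree more than D/2 and at least three
neighbours, and there are at least six vertices, so there is a matching of
size 3. Adding the three disjointness bounds excludes a seventh vertex and
shows that every perfect matching on six vertices carries at most D/2 edges,
whereas K_6 decomposes into five perfect matchings. *)

(** * Multigraphs in which every edge is disjoint from few others *)

Section MultigraphBound.

Variables (T : finType) (m : T -> T -> nat) (D e : nat).
Hypothesis m_sym : forall u v, m u v = m v u.
Hypothesis m_irr : forall u, m u u = 0.
Let d u := \sum_v m u v.
Hypothesis d_le : forall u, d u <= D.
Hypothesis sum_d : \sum_u d u = e.*2.
(** With [e] edges in all, [d u + d v - m u v] of them meet an edge uv; this says that at most [D]
    miss it. *)
Hypothesis few_disjoint : forall u v, 0 < m u v -> e + m u v <= d u + d v + D.
Hypothesis many_edges : 5 * D < e.*2.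

Let V := [set u | 0 < d u].

Lemma mem_supp_edge u v : 0 < m u v -> (u \in V) && (v \in V).
Proof.
move=> muv; rewrite !inE /d (bigD1 v) //= ltn_addr //=.
by rewrite (bigD1 u) //= m_sym ltn_addr.
Qed.

Lemma supp_neighbour u : u \in V -> exists v, 0 < m u v.
Proof.
rewrite inE lt0n sum_nat_eq0 negb_forall => /existsP[v].
by rewrite -lt0n; exists v.
Qed.

Lemma deg_gt_half u : u \in V -> D < 2 * d u.
Proof.
case/supp_neighbour=> v muv.
by have := few_disjoint muv; have := d_le v; lia.
Qed.

Lemma mult_lt u v : u \in V -> D + 2 * m u v < 2 * d u.
Proof.
move=> Vu; have := deg_gt_half Vu; have := d_le v.
have := @few_disjoint u v; lia.
Qed.

(** If all edges at [u] went to [p] or [q], adding [mult_lt] for both would give [D < d u]. *)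
Lemma third_neighbour u p q : u \in V ->
  exists w, [/\ 0 < m u w, w != p & w != q].
Proof.
move=> Vu; have [w /and3P[]|H] := pickP (fun w => [&& 0 < m u w, w != p & w != q]).
  by exists w.
have := mult_lt p Vu; have := mult_lt q Vu; have := d_le u.
suff: d u <= m u p + m u q by lia.
rewrite /d (bigD1 p) //= leq_add2l.
have [qp|qp] := eqVneq q p.
  by rewrite big1 // => w wp; have := H w; rewrite qp wp; lia.
rewrite (bigD1 q) //= big1 ?addn0 // => w /andP[wp wq].
by have := H w; rewrite wp wq; lia.
Qed.

Lemma sum_supp u : d u = \sum_(v in V) m u v.
Proof.
rewrite /d [RHS]big_mkcond; apply: eq_bigr => v _; case: ifPn => // nV.
by apply/eqP; rewrite -leqn0 leqNgt; apply: contra nV => /mem_supp_edge/andP[].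
Qed.

Lemma sum_d_supp : \sum_(u in V) d u = e.*2.
Proof.
rewrite -sum_d [LHS]big_mkcond; apply: eq_bigr => u _.
by rewrite inE; case: (d u).
Qed.

Lemma supp_card : 5 < #|V|.
Proof.
have : e.*2 <= #|V| * D by rewrite -sum_d_supp -sum_nat_const leq_sum.
by nia.
Qed.

(* Adding the disjointness bounds of the three matching edges. *)
Lemma matching3 a b c x p q : uniq [:: a; b; c; x; p; q] ->
  0 < m a b -> 0 < m c x -> 0 < m p q ->
  [/\ #|V| = 6 & 2 * (m a b + m c x + m p q) <= D].
Proof.
move=> U mab mcx mpq.
have sV : {subset [:: a; b; c; x; p; q] <= V}.
  move=> y; have /andP[? ?] := mem_supp_edge mab.
  have /andP[? ?] := mem_supp_edge mcx; have /andP[? ?] := mem_supp_edge mpq.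
  by rewrite !in_cons orbF => /or4P[|||/or3P[]] /eqP->.
have sum6 : \sum_(y <- [:: a; b; c; x; p; q]) d y = d a + d b + d c + d x + d p + d q.
  by rewrite !big_cons big_nil; lia.
have := few_disjoint mab; have := few_disjoint mcx; have := few_disjoint mpq.
move: sum_d_supp; rewrite (bigID (mem [:: a; b; c; x; p; q])) /=.
rewrite (eq_bigl (mem [:: a; b; c; x; p; q])); last first.
  by move=> y /=; apply/andb_idl/sV.
rewrite -big_uniq // sum6.
(* The three bounds leave less than D/2 for the degrees outside the matching, while a seventh
   support vertex has degree above D/2. *)
have [V6|V6] := eqVneq #|V| 6; first by split=> //; lia.
have [z /andP[zV zn]|none] := pickP (fun z => (z \in V) && (z \notin [:: a; b; c; x; p; q])).
  rewrite (bigD1 z) /=; last by rewrite zV.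
  by have := deg_gt_half zV; lia.
case/eqP: V6; rewrite -[RHS]/(size [:: a; b; c; x; p; q]) -(card_uniqP U).
apply: eq_card => y; apply/idP/idP => [yV|/sV //].
by have := none y; rewrite yV /= => /negbFE.
Qed.

(* Every support vertex has three neighbours, so two vertices missed by a
   matching of size two can augment it. *)
Lemma exists_matching3 : exists a b c x p q, [/\ uniq [:: a; b; c; x; p; q],
  0 < m a b, 0 < m c x & 0 < m p q].
Proof.
have pickV (s : seq T) : size s < 6 -> exists2 z, z \in V & z \notin s.
  move=> s6; have [z /andP[]|none] := pickP (fun z => (z \in V) && (z \notin s)).
    by exists z.
  have : #|V| <= #|s|.
    apply/subset_leq_card/subsetP => y yV.
    by have := none y; rewrite yV /= => /negbFE.
  by have := supp_card; have := card_size s; lia.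
have neq u v : 0 < m u v -> u != v by apply: contraTneq => ->; rewrite m_irr.
have [a Va _] := pickV [::] isT.
have [b mab] := supp_neighbour Va.
have [c Vc] := pickV [:: a; b] isT; rewrite !inE => /norP[ca cb].
have [x [mcx xa xb]] := third_neighbour a b Vc.
have [p Vp] := pickV [:: a; b; c; x] isT; rewrite !inE => /norP[pa /norP[pb /norP[pc px]]].
have [q Vq] := pickV [:: a; b; c; x; p] isT.
rewrite !inE => /norP[qa /norP[qb /norP[qc /norP[qx qp]]]].
have nab := neq _ _ mab; have ncx := neq _ _ mcx.
have distinct : uniq [:: a; b; c; x; p; q].
  rewrite /= !inE !negb_or; rewrite eq_sym in ca; rewrite eq_sym in cb.
  rewrite eq_sym in xa; rewrite eq_sym in xb; rewrite eq_sym in pa.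
  rewrite eq_sym in pb; rewrite eq_sym in pc; rewrite eq_sym in px.
  rewrite eq_sym in qa; rewrite eq_sym in qb; rewrite eq_sym in qc.
  rewrite eq_sym in qx; rewrite eq_sym in qp.
  by rewrite nab ca xa pa qa cb xb pb qb ncx pc qc px qx qp.
have perm s : perm_eq [:: a; b; c; x; p; q] s -> uniq s by move/perm_uniq <-.
(* Either [z] augments the matching directly, or three of its neighbours are among [a], [b], [c],
   [x]: both ends of one matching edge and an end of the other. *)
have three z : z \in V -> z \notin [:: a; b; c; x] ->
   (exists2 w, w \notin [:: a; b; c; x; z] & 0 < m z w) \/
   [|| [&& 0 < m z a, 0 < m z b & (0 < m z c) || (0 < m z x)] |
       [&& 0 < m z c, 0 < m z x & (0 < m z a) || (0 < m z b)]].
  move=> Vz zn.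
  have [w /andP[wn mw]|none] :=
      pickP (fun w => (w \notin [:: a; b; c; x; z]) && (0 < m z w)).
    by left; exists w.
  right.
  have hit s t : exists2 w, w \in [:: a; b; c; x] & [/\ 0 < m z w, w != s & w != t].
    have [w [mw ws wt]] := third_neighbour s t Vz; exists w => //.
    have := none w; rewrite mw andbT => /negbFE.
    rewrite !inE => /or4P[->|->|->|/orP[->|/eqP wz]]; rewrite ?orbT //.
    by move: mw; rewrite wz m_irr.
  have hits s t : [|| [&& 0 < m z a, a != s & a != t], [&& 0 < m z b, b != s & b != t],
     [&& 0 < m z c, c != s & c != t] | [&& 0 < m z x, x != s & x != t]].
    have [w] := hit s t; rewrite !inE => + [mw ws wt].
    by case/or4P=> /eqP <-; rewrite mw ws wt ?orbT.
  have := hits a b; have := hits a c; have := hits a x.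
  have := hits b c; have := hits b x; have := hits c x.
  rewrite !eqxx /= !andbF /=.
  by do 4!case: (0 < m z _); rewrite ?orbT ?andbT ?orbF //=.
have far z w : z \notin [:: a; b; c; x] -> w \notin [:: a; b; c; x; z] ->
    uniq [:: a; b; c; x; z; w].
  move=> zn wn; have U4 : uniq [:: a; b; c; x].
    by move: distinct; rewrite (cat_uniq [:: a; b; c; x] [:: p; q]) => /andP[].
  rewrite (cat_uniq [:: a; b; c; x] [:: z; w]) U4 /= !inE.
  move: zn wn; rewrite !inE !negb_or.
  by move=> /and4P[-> -> -> ->] /and5P[-> -> -> -> wz]; rewrite eq_sym wz.
have np : p \notin [:: a; b; c; x] by rewrite !inE !negb_or pa pb pc px.
have nq : q \notin [:: a; b; c; x] by rewrite !inE !negb_or qa qb qc qx.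
case: (three _ Vp np) => [[w wn mw]|P3].
  by exists a, b, c, x, p, w; split=> //; exact: far.
case: (three _ Vq nq) => [[w wn mw]|Q3].
  by exists a, b, c, x, q, w; split=> //; exact: far.
(* Augmentation: the matching edge uv is replaced by pu and qv, and gh is kept. *)
have join u v g h : 0 < m p u -> 0 < m q v -> 0 < m g h ->
   (forall P, count P [:: u; v; g; h] = count P [:: a; b; c; x]) ->
   exists a b c x p q, [/\ uniq [:: a; b; c; x; p; q], 0 < m a b, 0 < m c x & 0 < m p q].
  move=> mpu mqv mgh uv; exists p, u, q, v, g, h; split=> //; apply: perm.
  by apply/permP => P; move: (uv P) => /=; clear; lia.
case/orP: P3 => /and3P[P1 P2 _].
  have: (0 < m q a) || (0 < m q b) by case/orP: Q3 => /and3P[// -> ].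
  by case/orP=> mq; [apply: join P2 mq mcx _ | apply: join P1 mq mcx _] => P /=; clear; lia.
have: (0 < m q c) || (0 < m q x) by case/orP: Q3 => /and3P[// -> ].
by case/orP=> mq; [apply: join P2 mq mab _ | apply: join P1 mq mab _] => P /=; clear; lia.
Qed.

(** * Supports with exactly six vertices *)

Definition listing s := uniq s /\ V =i s.

(** Phrased with counts so that each concrete reordering is a goal for [lia]. *)
Lemma listing_perm s t : (forall P, count P s = count P t) -> listing s -> listing t.
Proof.
move=> /permP st [U Vs]; split; first by rewrite -(perm_uniq st).
by move=> y; rewrite Vs (perm_mem st).
Qed.

Lemma uniq_listing s : #|V| = size s -> uniq s -> {subset s <= V} -> listing s.
Proof.
move=> Vs U sV; split=> //; apply/fsym; apply/subset_cardP; last exact/subsetP.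
by rewrite Vs (card_uniqP U).
Qed.

Lemma deg_listing s u : listing s -> d u = \sum_(v <- s) m u v.
Proof. by case=> U Vs; rewrite sum_supp (eq_bigl _ _ Vs) big_uniq. Qed.

Lemma sum_listing s : listing s -> \sum_(u <- s) d u = e.*2.
Proof. by case=> U Vs; rewrite -sum_d_supp (eq_bigl _ _ Vs) big_uniq. Qed.

(** If [q] is joined to all of [a], [b], [c], [x], add the four disjointness bounds and use [d p] >
    D/2. Otherwise at most three multiplicities make up [d q], and adding [mult_lt] over three
    vertices suffices. *)
Lemma nonadjacent_deg a b c x p q :
  listing [:: a; b; c; x; p; q] -> m p q = 0 -> 3 * D < 4 * d q.
Proof.
move=> L mpq; have [_ Vs] := L.
have Vq : q \in V by rewrite Vs !inE eqxx !orbT.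
have Vp : p \in V by rewrite Vs !inE eqxx !orbT.
have dq := deg_listing q L; have sd := sum_listing L.
rewrite !big_cons big_nil m_irr (m_sym q p) mpq in dq sd.
have := deg_gt_half Vp.
have := @few_disjoint q a; have := @few_disjoint q b.
have := @few_disjoint q c; have := @few_disjoint q x.
have := mult_lt a Vq; have := mult_lt b Vq; have := mult_lt c Vq; have := mult_lt x Vq.
move: dq sd many_edges; clear -T.
move: (d _) (d _) (d _) (d _) (d _) (d _) (m _ _) (m _ _) (m _ _) (m _ _).
lia.
Qed.

(** Since [p] and [q] each have degree above 3D/4, adding the disjointness bounds of ab and cx
    leaves less than D/2 for their multiplicities. If one of the two is not an edge, [mult_lt]
    bounds the other. *)
Lemma matching6_nonadjacent a b c x p q :
  listing [:: a; b; c; x; p; q] -> m p q = 0 -> 2 * (m a b + m c x) <= D.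
Proof.
move=> L mpq; have dq := nonadjacent_deg L mpq.
have dp : 3 * D < 4 * d p.
  apply: (@nonadjacent_deg a b c x q p); last by rewrite m_sym.
  by apply: listing_perm L => P /=; clear; lia.
have sd := sum_listing L; rewrite !big_cons big_nil in sd.
have Vin y : y \in [:: a; b; c; x; p; q] -> y \in V by case: L => _ ->.
have := mult_lt b (Vin a _); rewrite !inE eqxx /= => /(_ isT).
have := mult_lt x (Vin c _); rewrite !inE eqxx /= !orbT => /(_ isT).
have := @few_disjoint a b; have := @few_disjoint c x.
have := d_le a; have := d_le c.
move: dq dp sd many_edges; clear -T; lia.
Qed.

Lemma matching6 a b c x p q :
  listing [:: a; b; c; x; p; q] -> 2 * (m a b + m c x + m p q) <= D.
Proof.
move=> L.
have [mpq|pq] := posnP (m p q).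
  by rewrite mpq addn0; apply: matching6_nonadjacent L mpq.
have [mcx|cx] := posnP (m c x).
  rewrite mcx addn0; apply: (@matching6_nonadjacent _ _ _ _ c x) => //.
  by apply: listing_perm L => P /=; clear; lia.
have [mab|ab] := posnP (m a b).
  rewrite mab add0n; apply: (@matching6_nonadjacent _ _ _ _ a b) => //.
  by apply: listing_perm L => P /=; clear; lia.
by case: L => U _; case: (matching3 U ab cx pq).
Qed.

(* A support of six vertices is excluded by decomposing K_6 into five perfect
   matchings. *)
Lemma many_edges_false : False.
Proof.
have [a [b [c [x [p [q [U ab cx pq]]]]]]] := exists_matching3.
have [V6 _] := matching3 U ab cx pq.
have L : listing [:: a; b; c; x; p; q].
  apply: uniq_listing => // y.
  have /andP[? ?] := mem_supp_edge ab; have /andP[? ?] := mem_supp_edge cx.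
  have /andP[? ?] := mem_supp_edge pq.
  by rewrite !in_cons orbF => /or4P[|||/or3P[]] /eqP->.
have M g h i j k l :
    (forall P, count P [:: a; b; c; x; p; q] = count P [:: g; h; i; j; k; l]) ->
    2 * (m g h + m i j + m k l) <= D.
  by move=> gl; apply/matching6/(listing_perm gl L).
(* Round-robin schedule: [q] stays fixed while the pentagon [a], [b], [c], [x], [p] rotates. *)
have M1 : 2 * (m q a + m b p + m c x) <= D by apply: M => P /=; clear; lia.
have M2 : 2 * (m q b + m c a + m x p) <= D by apply: M => P /=; clear; lia.
have M3 : 2 * (m q c + m x b + m p a) <= D by apply: M => P /=; clear; lia.
have M4 : 2 * (m q x + m p c + m a b) <= D by apply: M => P /=; clear; lia.
have M5 : 2 * (m q p + m a x + m b c) <= D by apply: M => P /=; clear; lia.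
have := sum_listing L; rewrite !big_cons big_nil !(deg_listing _ L) !big_cons !big_nil.
rewrite !m_irr (m_sym b a) (m_sym c b) (m_sym x c) (m_sym p x) (m_sym a c) (m_sym b x).
rewrite (m_sym a p) (m_sym c p) (m_sym x a) (m_sym p b).
rewrite (m_sym a q) (m_sym b q) (m_sym c q) (m_sym x q) (m_sym p q).
move: M1 M2 M3 M4 M5 many_edges; clear; lia.
Qed.

End MultigraphBound.

(** * From families of two-element sets to multiplicities *)

Lemma set2_of_mem (T : finType) (A : {set T}) u : #|A| = 2 -> u \in A ->
  exists2 w, u != w & A = [set u; w].
Proof.
move=> /eqP/cards2P[a [b [nab ->]]]; rewrite !inE => /orP[]/eqP->.
  by exists b.
by exists a; rewrite 1?eq_sym // setUC.
Qed.

Lemma multigraph_edges (I T : finType) (E : {set I}) (h : I -> {set T}) D :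
  {in E, forall x, #|h x| = 2} ->
  (forall u, #|[set x in E | u \in h x]| <= D) ->
  {in E, forall x, #|[set y in E | [disjoint h x & h y]]| <= D} ->
  2 * #|E| <= 5 * D.
Proof.
move=> h2 degD disjD; rewrite leqNgt; apply/negP => big.
pose m u v := #|[set x in E | (u != v) && (h x == [set u; v])]|.
have dE u : \sum_v m u v = #|[set x in E | u \in h x]|.
  under eq_bigr => v _ do rewrite /m -sum1dep_card big_mkcondr /=.
  rewrite exchange_big -sum1dep_card big_mkcondr /=; apply: eq_bigr => x xE.
  case: ifPn => [ux|nux]; last first.
    by rewrite big1 // => v _; case: ifP => // /andP[_ /eqP hx]; rewrite hx !inE eqxx in nux.
  have [w uw hx] := set2_of_mem (h2 x xE) ux.
  rewrite (bigD1 w) //= uw hx eqxx big1 // => v vw.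
  case: ifP => // /andP[uv /eqP/setP/(_ v)]; rewrite !inE eqxx orbT.
  by rewrite eq_sym (negPf uv) (negPf vw).
apply: (@many_edges_false T m D #|E|); last by rewrite -mul2n.
- by move=> u v; rewrite /m; apply: eq_card => x; rewrite !inE eq_sym setUC.
- by move=> u; apply/eqP; rewrite cards_eq0; apply/eqP/setP => x; rewrite !inE eqxx andbF.
- by move=> u; rewrite dE.
- under eq_bigr => u _ do rewrite dE -sum1dep_card big_mkcondr /=.
  rewrite exchange_big /= -mul2n mulnC -sum_nat_const; apply: eq_bigr => x xE.
  by rewrite -big_mkcond /= sum1_card h2.
- move=> u v; rewrite !dE card_gt0 => /set0Pn[x]; rewrite inE => /and3P[xE uv /eqP hx].
  (* The intersection counts the edges parallel to [x]; edges outside the union are disjoint from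
     [h x]. *)
  rewrite -cardsUI.
  have -> : m u v = #|[set x in E | u \in h x] :&: [set x in E | v \in h x]|.
    rewrite /m uv; apply: eq_card => y; rewrite !inE andTb; case: (boolP (y \in E)) => //= yE.
    apply/eqP/andP => [->|[uy vy]]; first by rewrite !inE !eqxx orbT.
    by apply/esym/eqP; rewrite eqEcard subUset !sub1set uy vy cards2 uv h2.
  rewrite addnAC leq_add2r.
  apply: leq_trans (leq_add (leqnn _) (disjD x xE)).
  apply: leq_trans (leq_card_setU _ _); apply/subset_leq_card/subsetP => y yE.
  rewrite !inE yE /=; have [_|/pred0Pn[w /andP[]]] := boolP [disjoint _ & _].
    by rewrite orbT.
  by rewrite /= hx !inE => /orP[]/eqP-> ->; rewrite ?orbT.
Qed.

(** * Union bound and degeneracy order *)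

Lemma leq_card_bigcup (I T : finType) (A : {set I}) (F : I -> {set T}) :
  #|\bigcup_(i in A) F i| <= \sum_(i in A) #|F i|.
Proof.
apply: (big_ind2 (fun (B : {set T}) n => #|B| <= n)) => [|B m C n Bm Cn|//].
  by rewrite cards0.
exact: leq_trans (leq_card_setU B C) (leq_add Bm Cn).
Qed.

(** By induction on vertex subsets: a vertex of degree at most [k] in the subset gets rank 0, and
    the ranks of the others shift up by one. *)
Lemma degeneracy_order (T : finType) (e : rel T) k : degenerate e k ->
  exists2 r : T -> nat, injective r &
    forall x, #|[set y | e x y && (r x < r y)]| <= k.
Proof.
move=> deg.
suff [r ri rk] : exists2 r : T -> nat, {in [set: T] &, injective r} &
    {in [set: T], forall x, #|[set y in [set: T] | e x y && (r x < r y)]| <= k}.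
  exists r => [x y|x]; first exact: ri.
  apply: leq_trans (rk x (in_setT x)).
  by apply/subset_leq_card/subsetP => y; rewrite !inE.
move: [set: T] => S; have [n] := ubnP #|S|; elim: n S => // n IH S Sn.
have [->|S0] := eqVneq S set0.
  by exists (fun=> 0) => [x y|x]; rewrite inE.
have [v vS vk] := deg S S0.
have [|r ri rk] := IH (S :\ v); first by move: Sn; rewrite (cardsD1 v) vS.
exists (fun x => if x == v then 0 else (r x).+1) => [x y xS yS|x xS].
  case: eqVneq => [->|xv]; case: eqVneq => [->|yv] // [] /ri; apply; rewrite inE.
    by rewrite inE xv.
  by rewrite inE yv.
have [->|xv] := eqVneq x v.
  apply: leq_trans vk; apply/subset_leq_card/subsetP => y.
  by rewrite !inE => /and3P[-> ->].
have xSv : x \in S :\ v by rewrite !inE xv.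
apply: leq_trans (rk x xSv); apply/subset_leq_card/subsetP => y.
by rewrite !inE; case: (eqVneq y v) => [_|yv]; rewrite ?ltn0 ?andbF ?(negPf xv).
Qed.

(** * Cliques in the square *)

Section SquareClique.

Variables (T : finType) (e : rel T) (D : nat) (r : T -> nat).
Hypotheses (e_sym : symmetric e) (e_irr : irreflexive e).
Hypothesis deg_le : max_degree_le e D.
Hypothesis r_inj : injective r.
Let out x := [set y | e x y && (r x < r y)].
Hypothesis out_le2 : forall x, #|out x| <= 2.
Variable S : {set T}.
Hypothesis clique : is_clique (square_rel e) S.

Let inn x := [set w | x \in out w].
Let d (A : {set T}) u := #|[set x in A | u \in out x]|.
Let reach x := out x :|: \bigcup_(w in out x) out w.

Lemma r_reach x y : y \in reach x -> r x < r y.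
Proof.
rewrite !inE => /orP[/andP[]//|/bigcupP[w]].
by rewrite !inE => /andP[_ xw] /andP[_]; apply: ltn_trans.
Qed.

Lemma card_bigcup_out (A : {set T}) : #|\bigcup_(w in A) out w| <= #|A| * 2.
Proof.
apply: leq_trans (leq_card_bigcup _ _) _.
by rewrite -sum_nat_const leq_sum.
Qed.

Lemma card_reach x : #|reach x| <= 6.
Proof.
apply: leq_trans (leq_card_setU _ _) _.
by have := card_bigcup_out (out x); have := out_le2 x; lia.
Qed.

Lemma card_inn x : #|inn x| <= D.
Proof.
apply: leq_trans (deg_le x); apply/subset_leq_card/subsetP => w.
by rewrite !inE e_sym => /andP[-> _].
Qed.

Lemma d_le (A : {set T}) u : d A u <= D.
Proof.
apply: leq_trans (card_inn u); apply/subset_leq_card/subsetP => x.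
by rewrite !inE => /and3P[_ -> ->].
Qed.

Definition common_inn x := [set y | (y != x) && [exists w, (x \in out w) && (y \in out w)]].

(** Each of the at most [D] in-neighbours of [x] has at most one other out-neighbour. *)
Lemma card_common_inn x : #|common_inn x| <= D.
Proof.
apply: leq_trans (card_inn x).
have : common_inn x \subset \bigcup_(w in inn x) (out w :\ x).
  apply/subsetP => y; rewrite inE => /andP[yx /existsP[w /andP[xw yw]]].
  by apply/bigcupP; exists w; [rewrite inE | rewrite in_setD1 yx].
move/subset_leq_card/leq_trans; apply.
apply: leq_trans (leq_card_bigcup _ _) _.
rewrite -sum1_card leq_sum // => w; rewrite inE => xw.
by have := out_le2 w; rewrite (cardsD1 x) xw.
Qed.

(** For a path x, z, y, the four orientations of its two edges give the four cases. *)
Lemma clique_pair x y : x \in S -> y \in S -> x != y ->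
  [\/ ~~ [disjoint out x & out y], y \in common_inn x, y \in reach x | x \in reach y].
Proof.
move=> xS yS xy.
have orient u v : e u v -> (v \in out u) || (u \in out v).
  rewrite !inE (e_sym v) => uv; rewrite uv /= -neq_ltn.
  by apply: contraTneq uv => /r_inj->; rewrite e_irr.
case/andP: (clique xS yS xy) => _ /orP[/orient/orP[yx|xy']|/existsP[z /andP[/orient xz /orient zy]]].
- by constructor 3; rewrite in_setU yx.
- by constructor 4; rewrite in_setU xy'.
case/orP: xz => xz; case/orP: zy => zy.
- by constructor 3; rewrite in_setU; apply/orP; right; apply/bigcupP; exists z.
- by constructor 1; apply/pred0Pn; exists z; rewrite /= xz zy.
- by constructor 2; rewrite inE eq_sym xy; apply/existsP; exists z; rewrite xz zy.
- by constructor 4; rewrite in_setU; apply/orP; right; apply/bigcupP; exists z.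
Qed.

Lemma card_touching (A : {set T}) x :
  #|[set y in A | ~~ [disjoint out x & out y]]| <= \sum_(u in out x) d A u.
Proof.
have : [set y in A | ~~ [disjoint out x & out y]] \subset
    \bigcup_(u in out x) [set y in A | u \in out y].
  apply/subsetP => y; rewrite inE => /andP[yA /pred0Pn[u /andP[ux uy]]].
  by apply/bigcupP; exists u => //; rewrite inE yA.
by move/subset_leq_card/leq_trans; apply; apply: leq_card_bigcup.
Qed.

Lemma clique_card_le x : x \in S ->
  #|S| <= 1 + \sum_(u in out x) d S u + D + 6 + #|[set y in S | x \in reach y]|.
Proof.
move=> xS.
have sub : S \subset [set x] :|: [set y in S | ~~ [disjoint out x & out y]]
    :|: common_inn x :|: reach x :|: [set y in S | x \in reach y].
  apply/subsetP => y yS; rewrite 4!in_setU in_set1.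
  have [->//|yx] := eqVneq y x.
  rewrite eq_sym in yx; case: (clique_pair xS yS yx) => h.
  - by rewrite [y \in [set _ in _ | ~~ _]]inE yS h !orbT.
  - by rewrite h !orbT.
  - by rewrite h !orbT.
  by rewrite [y \in [set _ in _ | x \in _]]inE yS h !orbT.
apply: leq_trans (subset_leq_card sub) _.
apply: leq_trans (leq_card_setU _ _) _; apply: leq_add => //.
apply: leq_trans (leq_card_setU _ _) _; apply: leq_add (card_reach x).
apply: leq_trans (leq_card_setU _ _) _; apply: leq_add (card_common_inn x).
apply: leq_trans (leq_card_setU _ _) _; apply: leq_add (card_touching S x).
by rewrite cards1.
Qed.

Let big := [set u | D <= 2 * d S u].
Let Y := big :|: \bigcup_(u in big) out u.

Hypothesis S_large : 5 * D + 86 < 2 * #|S|.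

(** The first vertex of [S] is reached from no vertex of [S], and its out-neighbours contribute at
    most 2D. *)
Lemma clique_card_upper : #|S| <= 3 * D + 7.
Proof.
have [x0 x0S] : exists x, x \in S by apply/set0Pn; rewrite -card_gt0; lia.
have [x xS xmin] := arg_minnP r x0S.
apply: leq_trans (clique_card_le xS) _.
have -> : [set y in S | x \in reach y] = set0.
  apply/setP => y; rewrite [LHS]inE in_set0; apply/negP => /andP[yS xy].
  by have := xmin y yS; have := r_reach xy; lia.
have : \sum_(u in out x) d S u <= #|out x| * D.
  by rewrite -sum_nat_const; apply: leq_sum => u _; exact: d_le.
by rewrite cards0; have := out_le2 x; nia.
Qed.

(** Double counting gives [#|big| * D <= 4 * #|S| <= 12 * D + 28], and [S_large] with
    [clique_card_upper] forces [D > 72], which rules out 13. *)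
Lemma card_big : #|big| <= 12.
Proof.
have : #|big| * D <= \sum_u 2 * d S u.
  rewrite -sum_nat_const big_mkcond; apply: leq_sum => u _.
  by rewrite inE; case: ifP.
have : \sum_u d S u <= #|S| * 2.
  under eq_bigr => u _ do rewrite /d -sum1dep_card big_mkcondr /=.
  rewrite exchange_big -sum_nat_const; apply: leq_sum => x xS.
  by rewrite -big_mkcond sum1_card.
rewrite -big_distrr /=; have := clique_card_upper; nia.
Qed.

Lemma card_exceptional : #|Y| <= 36.
Proof.
apply: leq_trans (leq_card_setU _ _) _.
by have := card_bigcup_out big; have := card_big; lia.
Qed.

Lemma reach_big y : out y \subset big -> reach y \subset Y.
Proof.
move=> yb; apply: setUSS => //; apply/bigcupsP => w wy.
by apply: bigcup_sup; apply: (subsetP yb).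
Qed.

Lemma nonexceptional x : x \in S -> x \notin Y -> (#|out x| == 2) && (out x \subset big).
Proof.
pose bad x := [&& x \in S, x \notin Y & ~~ ((#|out x| == 2) && (out x \subset big))].
move=> xS xY; apply: contraT => xb.
have x_bad : bad x by rewrite /bad xS xY.
have [z /and3P[zS zY zb] zmin] := arg_minnP r x_bad.
(* A vertex reaching [z] precedes it, so it is not bad by minimality; outside [Y] it would reach
   only elements of [Y], and [z] is not one. *)
have cz : #|[set y in S | z \in reach y]| <= 36.
  apply: leq_trans card_exceptional; apply/subset_leq_card/subsetP => y.
  rewrite inE => /andP[yS zy]; apply: contraT => yY.
  have [/andP[_ /reach_big/subsetP/(_ z zy)]|yb] := boolP ((#|out y| == 2) && (out y \subset big)).
    by rewrite (negPf zY).
  have := zmin y; rewrite /bad yS yY yb => /(_ isT).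
  by have := r_reach zy; lia.
have := clique_card_le zS.
(* Then [clique_card_le] gives 1 + 3D/2 + D + 6 + 36, the source of the constant 43 = 86/2. *)
suff: 2 * \sum_(u in out z) d S u <= 3 * D by lia.
have [z2|z1] := eqVneq #|out z| 2.
  move: zb; rewrite z2 /= => /subsetPn[u uz]; rewrite inE -ltnNge => du.
  have [w uw ->] := set2_of_mem z2 uz.
  by rewrite big_setU1 ?inE //= big_set1; have := d_le S w; lia.
have : \sum_(u in out z) d S u <= #|out z| * D.
  by rewrite -sum_nat_const; apply: leq_sum => u _; exact: d_le.
have := out_le2 z; nia.
Qed.

Lemma large_clique_false : False.
Proof.
have : 2 * #|S :\: Y| <= 5 * D.
  apply: (@multigraph_edges _ _ _ out).
  - by move=> x; rewrite inE => /andP[xY xS]; have /andP[/eqP] := nonexceptional xS xY.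
  - exact: d_le.
  move=> x; rewrite inE => /andP[xY xS]; apply: leq_trans (card_common_inn x).
  apply/subset_leq_card/subsetP => y; rewrite inE in_setD => /andP[/andP[yY yS] dxy].
  have reachY u v : u \in S -> u \notin Y -> v \notin Y -> v \notin reach u.
    move=> uS uY; apply: contra; apply/subsetP/reach_big.
    by have /andP[] := nonexceptional uS uY.
  have [xy|xy] := eqVneq x y.
    move: dxy; rewrite -xy -setI_eq0 setIid => /eqP o0.
    by have := nonexceptional xS xY; rewrite o0 cards0.
  (* Disjoint out-sets, and no reaching outside [Y], leave only a common in-neighbour. *)
  case: (clique_pair xS yS xy) => //; first by rewrite dxy.
    by rewrite (negPf (reachY _ _ xS xY yY)).
  by rewrite (negPf (reachY _ _ yS yY xY)).
have := card_exceptional; have := cardsID Y S; have := subset_leq_card (subsetIr S Y).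
lia.
Qed.

End SquareClique.

(* omega(G^2) <= 5/2 D + c  is written as  2 * omega <= 5 * D + 2 * c. *)
Theorem theorem1 :
  forall (D : nat), 0 < D ->
  forall (T : finType) (e : rel T),
    simple_graph e -> degenerate e 2 -> max_degree_le e D ->
    clique_number_le (square_rel e) (fun w => 2 * w <= 5 * D + 144) /\
    (1729 <= D -> clique_number_le (square_rel e) (fun w => 2 * w <= 5 * D + 120)).
Proof.
move=> D _ T e [e_sym e_irr] /degeneracy_order[r r_inj r_out] deg_le.
have bound K : is_clique (square_rel e) K -> 2 * #|K| <= 5 * D + 86.
  move=> clK; rewrite leqNgt; apply/negP => K_large.
  exact: (large_clique_false e_sym e_irr deg_le r_inj r_out clK K_large).
split=> [|_] K /bound; lia.
Qed.
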